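(* Let $\bm q=(q_0,\ldots,q_n)$ with $q_i\in\mathcal{S}^h(\mathbb{K}^{m+1})$, $k$ a positive integer and $W_{\bm q}:\mathcal{S}^k(\mathbb{K}^{n+1})\to\mathcal{S}^{hk}(\mathbb{K}^{m+1})$ the linear map $\bm X^{\bm\alpha}\mapsto\bm q^{\bm\alpha}=\prod_{i=0}^nq_i(\bm Z)^{\alpha_i}$. (1) Let $\bm q'=(q'_0,\ldots,q'_n)$ with $q_i'\in\mathcal{S}^h(\mathbb{K}^{m+1})$ and let $W_{\bm q'}$ be the corresponding linear map $\bm X^{\bm\alpha}\mapsto\bm q'^{\bm\alpha}$. If $\mathrm{span}(\bm q)=\mathrm{span}(\bm q')$, then $\mathrm{span}(\bm q^{\bm\alpha}\mid\bm\alpha\in M_{k,n+1})=\mathrm{span}(\bm q'^{\bm\alpha}\mid\bm\alpha\in M_{k,n+1})$, i.e. $\mathrm{Im}(W_{\bm q})=\mathrm{Im}(W_{\bm q'})$. (2) If the family $(\bm q^{\bm\alpha})_{\bm\alpha\in M_{k,n+1}}$ is linearly independent in $\mathcal{S}^{hk}(\mathbb{K}^{m+1})$, then $\bm q=(q_0,\ldots,q_n)$ is linearly independent in $\mathcal{S}^h(\mathbb{K}^{m+1})$. (3) If $\bm q=(\bm Z^{\bm\beta}\mid\bm\beta\in M_{h,m+1})$ is the standard monomial basis of $\mathcal{S}^h(\mathbb{K}^{m+1})$, then the set $\{\bm q^{\bm\alpha}\mid\bm\alpha\in M_{k,n+1}\}$ is the standard monomial basis of $\mathcal{S}^{hk}(\mathbb{K}^{m+1})$,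 and therefore $W_{\bm q}$ is surjective.
   Context: $\mathbb{K}=\mathbb{R}$ or $\mathbb{C}$; $m,n,h$ are positive integers. $\mathcal{S}^d(\mathbb{K}^{N+1})$ is the space of homogeneous polynomials of degree $d$ in $N+1$ variables over $\mathbb{K}$; variables are $\bm X=(X_0,\dots,X_n)$, respectively $\bm Z=(Z_0,\dots,Z_m)$. $M_{d,N+1}=\{\bm\alpha\in\mathbb{N}_0^{N+1}:|\bm\alpha|=\sum\alpha_i=d\}$. The standard monomial basis of $\mathcal{S}^d(\mathbb{K}^{m+1})$ is $\{\bm Z^{\bm\beta}\mid\bm\beta\in M_{d,m+1}\}$. *)

(* Defs.v *)
From HB Require Import structures.
From mathcomp Require Import all_boot all_order all_algebra.
From mathcomp Require Export reals complex mpoly.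

Set Implicit Arguments.
Unset Strict Implicit.
Unset Printing Implicit Defensive.

Import GRing.Theory.

Local Open Scope ring_scope.

Definition multi_indices (d N : nat) : seq 'X_{1..N} :=
  [seq bmnm a | a <- enum {: 'X_{1..N < d.+1}} & mdeg (bmnm a) == d].

Lemma mem_multi_indices d N (a : 'X_{1..N}) :
  (a \in multi_indices d N) = (mdeg a == d).
Proof.
apply/mapP/eqP => [[b]|ad].
  by rewrite mem_filter => /andP[/eqP bd _] ->.
have ltad : (mdeg a < d.+1)%N by rewrite ad.
by exists (BMultinom ltad); rewrite // mem_filter mem_enum /= ad eqxx.
Qed.

Lemma uniq_multi_indices d N : uniq (multi_indices d N).
Proof.
rewrite map_inj_uniq; last by move=> a b; apply: val_inj.
exact/filter_uniq/enum_uniq.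
Qed.

Lemma indhomogK (K : fieldType) N d (p : {mpoly K[N]}) :
  p \is d.-homog -> mpoly_of_dhomog (indhomog d p) = p.
Proof. by move=> hp; rewrite /indhomog val_insubd hp. Qed.

Section Monomials.

Variable K : fieldType.

(* [indhomog d p] is p seen as a form of degree d, and 0 if p is not one;
   [monomE] and [powqE] show that the default value is never reached. *)
Definition monom N d (a : 'X_{1..N}) : dhomog N K d := indhomog d 'X_[a].

Lemma monomE N d (a : 'X_{1..N}) :
  mdeg a = d -> mpoly_of_dhomog (monom d a) = 'X_[a].
Proof. by move=> ad; rewrite indhomogK // dhomogX; apply/eqP. Qed.

Definition monomials N d : seq (dhomog N K d) :=
  [seq monom d a | a <- multi_indices d N].

Lemma dhomog_sum_monom N d (p : dhomog N K d) :
  p = \sum_(a <- multi_indices d N) (p : {mpoly K[N]})@_a *: monom d a.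
Proof.
apply/val_inj => /=; rewrite raddf_sum /=; apply/mpolyP => b.
rewrite raddf_sum /= big_seq.
under eq_bigr => a.
  rewrite mem_multi_indices => /eqP ad.
  rewrite linearZ_LR /= monomE // mcoeffX; over.
rewrite -big_seq; have [bd|bd] := eqVneq (mdeg b) d.
  rewrite (bigD1_seq b) ?uniq_multi_indices ?mem_multi_indices ?bd //=.
  rewrite eqxx mulr1 big1 ?addr0 // => a /negPf ab.
  by rewrite ab mulr0.
rewrite (dhomog_nemf_coeff (dhomog_is_dhomog p) bd) big_seq big1 // => a.
rewrite mem_multi_indices => /eqP ad; case: eqP => [ab|_]; last exact: mulr0.
by rewrite -ab ad eqxx in bd.
Qed.

Lemma monomials_basis N d : basis_of fullv (monomials N.+1 d).
Proof.
rewrite basisEdim; apply/andP; split.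
  apply/subvP => p _; rewrite (dhomog_sum_monom p) big_seq.
  apply: memv_suml => a am; apply: memvZ; apply: memv_span.
  exact: map_f.
rewrite size_map dimvf /dim /= -(size_basis N d).
rewrite uniq_leq_size ?uniq_multi_indices // => a.
by rewrite mem_multi_indices basis_cover.
Qed.

End Monomials.

Section PowerMap.

Variables (K : fieldType) (m n h k : nat).
Implicit Type q : n.+1.-tuple (dhomog m.+1 K h).

Definition powq q (a : 'X_{1..n.+1}) : dhomog m.+1 K (h * k) :=
  indhomog (h * k)
    (\prod_(i < n.+1) (tnth q i : {mpoly K[m.+1]}) ^+ a i).

Lemma powqE q (a : 'X_{1..n.+1}) : mdeg a = k ->
  mpoly_of_dhomog (powq q a)
    = \prod_(i < n.+1) (tnth q i : {mpoly K[m.+1]}) ^+ a i.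
Proof.
move=> ak; rewrite indhomogK // -ak mdegE big_distrr /=.
elim/big_rec2: _ => [|i p d _ hp]; first exact: dhomog1.
by apply: dhomogM => //; apply/dhomogMn/dhomog_is_dhomog.
Qed.

Definition powers q : seq (dhomog m.+1 K (h * k)) :=
  [seq powq q a | a <- multi_indices k n.+1].

Definition Wfun q (p : dhomog n.+1 K k) : dhomog m.+1 K (h * k) :=
  \sum_(a <- multi_indices k n.+1) (p : {mpoly K[n.+1]})@_a *: powq q a.

Lemma Wfun_is_linear q : linear (Wfun q).
Proof.
move=> c p r; rewrite /Wfun scaler_sumr -big_split /=.
apply: eq_bigr => a _.
by rewrite linearP /= scalerDl scalerA.
Qed.

HB.instance Definition _ q :=
  GRing.isLinear.Build K (dhomog n.+1 K k) (dhomog m.+1 K (h * k)) _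
    (Wfun q) (Wfun_is_linear q).

Definition W q : 'Hom(dhomog n.+1 K k, dhomog m.+1 K (h * k)) :=
  linfun (Wfun q).

Lemma W_monom q (a : 'X_{1..n.+1}) :
  mdeg a = k -> W q (monom K k a) = powq q a.
Proof.
move=> ak; rewrite lfunE /= /Wfun.
rewrite (bigD1_seq a) ?uniq_multi_indices ?mem_multi_indices ?ak //=.
rewrite monomE // mcoeffX eqxx scale1r big1 ?addr0 // => b ba.
by rewrite mcoeffX eq_sym (negPf ba) scale0r.
Qed.

End PowerMap.

Arguments powq {K m n h} k q a.
Arguments powers {K m n h} k q.
Arguments W {K m n h} k q.

(* Main.v *)
(** W_q is the substitution X_i := q_i, hence multiplicative, and its image is
    the span of the powers q^a.  (1) If q_i = \sum_j c_ij q'_j, then q^a is the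
    image under W_q' of \prod_i (\sum_j c_ij X_j)^a_i.  (2) If the powers of q
    are free, W_q is injective; a linear relation \sum_j c_j q_j = 0 puts
    X_0^(k-1) \sum_j c_j X_j in its kernel, so c = 0.  (3) Every multi-index of
    degree h * k is a sum of k multi-indices of degree h. *)

Require Import Defs.
From HB Require Import structures.
From mathcomp Require Import all_boot all_order all_algebra.

Set Implicit Arguments.
Unset Strict Implicit.
Unset Printing Implicit Defensive.

Import GRing.Theory.
Local Open Scope ring_scope.

(** Grow [b] from [0] one unit at a time: while its degree is below that of [c], some coordinate is
    still strictly smaller and can be raised. *)
Lemma exists_lem_mdeg N (c : 'X_{1..N}) d : (d <= mdeg c)%N ->
  exists2 b : 'X_{1..N}, (b <= c)%MM & mdeg b = d.
Proof.
elim: d => [|d IHd] dc.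
  by exists 0%MM; rewrite ?mdeg0 //; apply/mnm_lepP => i; rewrite mnm0E.
have [b bc bd] := IHd (ltnW dc).
have [i bi] : exists i, (b i < c i)%N.
  apply/existsP; apply: contraLR dc => /existsPn cb.
  by rewrite -leqNgt -bd !mdegE; apply: leq_sum => i _; rewrite leqNgt cb.
exists (b + U_(i))%MM; last by rewrite mdegD mdeg1 bd addn1.
apply/mnm_lepP => j; rewrite mnmDE mnm1E.
by case: eqP => [<-|_]; rewrite ?addn1 // addn0; apply/mnm_lepP.
Qed.

(** Peel off from [c] a multi-index of degree [h] below it, [k] times; [a] counts how often each
    [b i] has been removed. *)
Lemma exists_sum_mulmn N M h k (b : 'I_M -> 'X_{1..N}) (c : 'X_{1..N}) :
    (forall d, mdeg d = h -> exists i, b i = d) -> mdeg c = (h * k)%N ->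
  exists2 a : 'X_{1..M}, mdeg a = k & (\sum_(i < M) b i *+ a i)%MM = c.
Proof.
move=> bsurj; elim: k c => [|k IHk] c cd.
  exists 0%MM; first by rewrite mdeg0.
  rewrite big1 => [|i _]; last by rewrite mnm0E mulm0n.
  by apply/esym/eqP; rewrite -mdeg_eq0 cd muln0.
have [|d dc dh] := @exists_lem_mdeg _ c h; first by rewrite cd mulnS leq_addr.
have [i bi] := bsurj d dh.
have [|a ak ac] := IHk (c - d)%MM.
  by apply: (@addIn h); rewrite -{1}dh -mdegD submK // cd mulnS addnC.
exists (a + U_(i))%MM; first by rewrite mdegD mdeg1 ak addn1.
rewrite -(submK dc) -ac -bi.
rewrite (bigD1 i) //= [in RHS](bigD1 i) //= mnmDE mnm1E eqxx addn1 mulmSr.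
rewrite -!addmA [X in _ = (_ + X)%MM]addmC; congr (_ + (_ + _))%MM.
apply: eq_bigr => j /negPf ji.
by rewrite mnmDE mnm1E eq_sym ji addn0.
Qed.

(** [coord] selects one expansion of [v] even when [X] is linearly dependent. *)
Lemma memv_span_tuple (K : fieldType) (vT : vectType K) N (X : N.-tuple vT) v :
  v \in <<X>>%VS -> v = \sum_(i < N) coord X i v *: tnth X i.
Proof.
move/coord_span => {1}->; apply: eq_bigr => i _.
by rewrite (tnth_nth 0).
Qed.

Section PowerMapTheory.

Variables (K : fieldType) (m n h k : nat).
Implicit Types (q : n.+1.-tuple (dhomog m.+1 K h)) (p : dhomog n.+1 K k).

Definition polys q : n.+1.-tuple {mpoly K[m.+1]} :=
  map_tuple (@mpoly_of_dhomog _ _ _) q.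

(** Both sides are linear in [p], so it suffices to compare them on monomials. This form makes the
    multiplicativity of substitution available. *)
Lemma W_comp q p :
  (W k q p : {mpoly K[m.+1]}) = (p : {mpoly K[n.+1]}) \mPo polys q.
Proof.
rewrite lfunE [in RHS](dhomog_sum_monom p) /= /Wfun.
rewrite 2!linear_sum /= linear_sum big_seq [RHS]big_seq; apply: eq_bigr => a.
rewrite mem_multi_indices => /eqP ak.
rewrite !linearZ /= powqE // monomE //.
by rewrite comp_mpolyX; congr (_ *: _); apply: eq_bigr => i _; rewrite tnth_map.
Qed.

Lemma limg_W q : limg (W k q) = <<powers k q>>%VS.
Proof.
rewrite -(span_basis (monomials_basis K n k)) limg_span.
rewrite -map_comp; congr <<_>>%VS; apply/eq_in_map => a.
by rewrite mem_multi_indices => /eqP ak; rewrite /= W_monom.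
Qed.

(** Kept in the polynomial ring rather than in [dhomog], so that products and powers can be formed
    freely. *)
Definition linear_form (c : 'I_n.+1 -> K) : {mpoly K[n.+1]} :=
  \sum_(j < n.+1) c j *: 'X_j.

Lemma linear_form_homog c : linear_form c \is 1.-homog.
Proof.
by apply: rpred_sum => j _; apply: rpredZ; rewrite dhomogX /= mdeg1.
Qed.

Lemma comp_linear_form c q :
  linear_form c \mPo polys q
    = \sum_(j < n.+1) c j *: (tnth q j : {mpoly K[m.+1]}).
Proof.
rewrite /linear_form raddf_sum; apply: eq_bigr => j _.
by rewrite /= comp_mpolyZ comp_mpolyXU -tnth_nth tnth_map.
Qed.

Lemma span_powersS q q' : (<<q>> <= <<q'>>)%VS ->
  (<<powers k q>> <= <<powers k q'>>)%VS.
Proof.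
move=> qq'; apply/span_subvP => _ /mapP[a + ->].
rewrite mem_multi_indices => /eqP ak; rewrite -limg_W.
(* Substituting [q'] into [L i] gives back the [i]-th entry of [q]. *)
pose L i := linear_form (fun j => coord q' j (tnth q i)).
(* Homogeneity ensures that [indhomog] below returns the product and not its default value 0. *)
have Lhom : \prod_(i < n.+1) L i ^+ a i \is k.-homog.
  rewrite -ak mdegE; elim/big_rec2: _ => [|i d p _ hp]; first exact: dhomog1.
  apply: dhomogM => //; rewrite -[X in X.-homog]mul1n.
  exact/dhomogMn/linear_form_homog.
suff -> : powq k q a = W k q' (indhomog k (\prod_(i < n.+1) L i ^+ a i)).
  exact/memv_img/memvf.
apply: val_inj; rewrite /= W_comp powqE // indhomogK // rmorph_prod.
apply: eq_bigr => i _ /=; rewrite rmorphXn /= comp_linear_form.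
have /memv_span_tuple {1}-> : tnth q i \in <<q'>>%VS.
  by apply/(subvP qq')/memv_span/mem_tnth.
by rewrite raddf_sum; congr (_ ^+ _); apply: eq_bigr => j _; rewrite linearZ.
Qed.

(** Rank-nullity: the image is spanned by the free family of powers, which has as many members as
    the monomial basis of the source, so the kernel has dimension 0. *)
Lemma W_eq0 q p : free (powers k q) -> W k q p = 0 -> p = 0.
Proof.
move=> qfree Wp0; suff /lker0P Winj : lker (W k q) == 0%VS.
  by apply: Winj; rewrite Wp0 linear0.
have := limg_ker_dim (W k q) fullv; rewrite capfv limg_W.
rewrite (eqP qfree) -(span_basis (monomials_basis K n k)).
rewrite (eqP (basis_free (monomials_basis K n k))) !size_map => /eqP.
by rewrite -{2}[size _]add0n eqn_add2r dimv_eq0.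
Qed.

Lemma free_powers q : (0 < k)%N -> free (powers k q) -> free q.
Proof.
move=> k_gt0 qfree; apply/freeP => c c0.
(* The factor ['X_ord0 ^+ k.-1] lifts the linear form to degree [k], using [0 < k]; substituting [q]
   turns the other factor into the given relation, which is 0. *)
pose p := 'X_ord0 ^+ k.-1 * linear_form c.
have phom : p \is k.-homog.
  suff : p \is (1 * k.-1 + 1).-homog by rewrite mul1n addn1 prednK.
  apply: dhomogM (linear_form_homog c); apply: dhomogMn.
  by rewrite dhomogX /= mdeg1.
have p0 : indhomog k p = 0.
  apply: W_eq0 qfree _; apply: val_inj; rewrite /= W_comp indhomogK // rmorphM /=.
  rewrite comp_linear_form; set s := \sum_(j < _) _.
  suff -> : s = 0 by rewrite mulr0.
  transitivity (mpoly_of_dhomog (\sum_(i < n.+1) c i *: q`_i)).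
    rewrite raddf_sum; apply: eq_bigr => i _.
    by rewrite [RHS]linearZ /= (tnth_nth 0).
  by rewrite c0.
have /eqP : p = 0 by rewrite -(indhomogK phom) p0.
(* Polynomials over a field have no zero divisors and the variable is nonzero, so the linear form
   vanishes; its coefficient at [U_(i)] is [c i]. *)
rewrite mulf_eq0 expf_eq0 -msize_poly_eq0 msizeX andbF /= => /eqP l0 i.
have := congr1 (mcoeff U_(i)) l0; rewrite mcoeff0 raddf_sum /= (bigD1 i) //=.
rewrite mcoeffZ mcoeffX eqxx mulr1 big1 ?addr0 // => j ji.
by rewrite mcoeffZ mcoeffX eq_mnm1 (negPf ji) mulr0.
Qed.

(** If [q] lists the monomials with exponents [b i], its power of index [a] is the monomial with
    exponent the sum of the [b i *+ a i]. Distinct [a] may give the same monomial, hence an equality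
    of sets only. *)
Lemma powers_monomials q :
  perm_eq q (monomials K m.+1 h) ->
  powers k q =i monomials K m.+1 (h * k).
Proof.
move=> qmon.
have bP i : exists2 b, mdeg b == h & tnth q i == monom K h b.
  have := mem_tnth i q; rewrite (perm_mem qmon) => /mapP[b].
  by rewrite mem_multi_indices => bh ->; exists b.
have /fin_all_exists2 [b bh bq] := bP.
have bsurj d : mdeg d = h -> exists i, b i = d.
  move=> dh; have : monom K h d \in q.
    by rewrite (perm_mem qmon); apply: map_f; rewrite mem_multi_indices dh.
  case/tnthP => i /esym; rewrite (eqP (bq i)) => /(congr1 (@mpoly_of_dhomog _ _ _)).
  rewrite !monomE //; last exact/eqP.
  (* Equal monomials have equal exponents: otherwise the coefficient at [d] would give 1 = 0. *)
  move/(congr1 (mcoeff d)); rewrite !mcoeffX eqxx.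
  by case: eqP => [bd _|_ /esym/eqP]; [exists i | rewrite oner_eq0].
have powqb a : mdeg a = k ->
    powq k q a = monom K (h * k) (\sum_(i < n.+1) b i *+ a i)%MM.
  move=> ak; apply: val_inj; rewrite /= powqE // monomE.
    rewrite -mprodXnE; apply: eq_bigr => i _.
    by rewrite (eqP (bq i)) monomE //; apply/eqP.
  rewrite mdeg_sum -ak mdegE big_distrr; apply: eq_bigr => i _ /=.
  by rewrite mdegMn (eqP (bh i)).
move=> x; apply/mapP/mapP => -[a]; rewrite mem_multi_indices => /eqP ak ->.
  exists (\sum_(i < n.+1) b i *+ a i)%MM; last exact: powqb.
  rewrite mem_multi_indices mdeg_sum -ak mdegE big_distrr; apply/eqP.
  by apply: eq_bigr => i _ /=; rewrite mdegMn (eqP (bh i)).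
(* Conversely, a monomial of degree [h * k] splits into [k] monomials of degree [h], each an entry
   of [q]. *)
have [c ck <-] := exists_sum_mulmn bsurj ak.
by exists c; rewrite ?powqb // mem_multi_indices ck.
Qed.

Lemma W_surj q : powers k q =i monomials K m.+1 (h * k) ->
  forall g, exists f, W k q f = g.
Proof.
move=> qmon g; have : g \in limg (W k q).
  by rewrite limg_W (eq_span qmon) (span_basis (monomials_basis _ _ _)) memvf.
by case/memv_imgP => f _ ->; exists f.
Qed.

End PowerMapTheory.

Theorem proposition3p11 (R : realType) (K : fieldType)
    (hK : K = (R : fieldType) \/ K = (R[i] : fieldType))
    (m n h k : nat)
    (m_gt0 : (0 < m)%N) (n_gt0 : (0 < n)%N)
    (h_gt0 : (0 < h)%N) (k_gt0 : (0 < k)%N)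
    (q : n.+1.-tuple (dhomog m.+1 K h)) :
  (forall q' : n.+1.-tuple (dhomog m.+1 K h),
     <<q>>%VS = <<q'>>%VS ->
     <<powers k q>>%VS = <<powers k q'>>%VS /\
     limg (W k q) = limg (W k q'))
  /\ (free (powers k q) -> free q)
  /\ (perm_eq q (monomials K m.+1 h) ->
      powers k q =i monomials K m.+1 (h * k) /\
      (forall g : dhomog m.+1 K (h * k),
         exists f : dhomog n.+1 K k, W k q f = g)).
Proof.
split=> [q' qq'|].
  have eq_powers : <<powers k q>>%VS = <<powers k q'>>%VS.
    by apply: subv_anti; rewrite !span_powersS // qq'.
  by rewrite !limg_W.
split=> [|qmon]; first exact: free_powers.
have powers_qmon := powers_monomials (k := k) qmon.
by split=> //; apply: W_surj.
Qed.
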